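(* Let $\mathcal{D}_{\mathbb{P}}=(\mathcal{D},\mathbb{P})$ be an uncertain Markov chain with parameter space $\mathcal{V}_{\mathcal{D}}$, and let $\varphi_r=\mathbb{P}_{\le\lambda}(\lozenge T)$ be a reachability specification. Let $\mathcal{U}\subseteq\mathcal{V}_{\mathcal{D}}$ be a set of $K=|\mathcal{U}|\ge 2$ parameter instantiations sampled independently according to $\mathbb{P}$, and assume that $\mathcal{D}[u]\models\varphi_r$ for all $u\in\mathcal{U}$. For a given tolerance probability $\nu\in[0,1)$, let the associated confidence probability be $$\alpha_\nu=\sum_{i=0}^{1}\binom{K}{i}(1-\nu)^{K-i}\nu^i.$$ Then, with probability at least $1-\alpha_\nu$ (with respect to the random drawing of the samples), we have $F(\mathcal{D}_{\mathbb{P}},\varphi_r)\ge 1-\nu$.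
   Context: A parametric Markov chain (pMC) is $\mathcal{D}=(S,s_I,V,\mathcal{P})$ with finite state set $S$, initial state $s_I$, finite set $V$ of real-valued parameters, and transition function $\mathcal{P}:S\times S\to\mathbb{Q}[V]$ (polynomials over $V$). For an instantiation $u$ of the parameters, $\mathcal{D}[u]$ is obtained by replacing each polynomial $f$ by $f[u]$. The parameter space $\mathcal{V}_{\mathcal{D}}$ consists of instantiations such that $\mathcal{D}[u]$ is a Markov chain (well-defined probability distributions), all assumed graph-preserving (nonzero transitions stay in $(0,1]$). An uncertain Markov chain (uMC) is a pair $(\mathcal{D},\mathbb{P})$ with $\mathbb{P}$ a probability distribution over $\mathcal{V}_{\mathcal{D}}$. For a target set $T\subseteq S$ and $\lambda\in[0,1]$, a Markov chain satisfies $\varphi_r=\mathbb{P}_{\le\lambda}(\lozenge T)$ iff the probability of reaching $T$ from the initial state is at most $\lambda$. The satisfaction probability is $F(\mathcal{D}_{\mathbb{P}},\varphi)=\int_{\mathcal{V}_{\mathcal{D}}} I_\varphi(u)\,d\mathbb{P}(u)$, where $I_\varphi(u)=1$ iff $\mathcal{D}[u]\models\varphi$ and $0$ otherwise. *)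

(* Defs.v *)
From HB Require Import structures.
From mathcomp Require Import all_boot all_order all_algebra.
(* The notations of mpoly clash with those of MathComp-Analysis. *)
From mathcomp Require Import -(notations) mpoly.
From mathcomp Require Import all_classical all_reals all_analysis.
From mathcomp Require Import ring lra.

Set Implicit Arguments.
Unset Strict Implicit.
Unset Printing Implicit Defensive.

Import Order.TTheory GRing.Theory Num.Theory.
Import numFieldNormedType.Exports.

Local Open Scope classical_set_scope.
Local Open Scope ring_scope.

Record markov_chain (R : realType) (S : finType) := MarkovChain {
  mc_init : S;
  mc_trans : S -> S -> R;
  mc_trans_ge0 : forall s t, 0 <= mc_trans s t;
  mc_trans_sum1 : forall s, \sum_t mc_trans s t = 1 }.

Section PathMeasure.
Context {R : realType} {S : finType}.
Implicit Type M : markov_chain R S.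

(* [M] only serves to make the type of infinite paths pointed, as required of
   measurable types; paths need not follow the transitions of [M]. *)
Definition path_of M : Type := nat -> S.

HB.instance Definition _ M := gen_eqMixin (path_of M).
HB.instance Definition _ M := gen_choiceMixin (path_of M).
HB.instance Definition _ M := isPointed.Build (path_of M) (fun=> mc_init M).

Definition cylinder M (w : seq S) : set (path_of M) :=
  [set p | mkseq p (size w) = w].

Definition cylinders M : set_system (path_of M) := range (@cylinder M).

Definition path_space M := g_sigma_algebraType (@cylinders M).

Fixpoint word_weight M (s : S) (w : seq S) : R :=
  if w is t :: w' then mc_trans M s t * word_weight M t w' else 1.

Definition word_prob M (w : seq S) : R :=
  if w is s :: w' then (s == mc_init M)%:R * word_weight M s w' else 1.

Definition is_path_measure M (mu : probability (path_space M) R) :=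
  forall w : seq S, mu (@cylinder M w) = (word_prob M w)%:E.

(* Existence of the path measure.  The interval [0, 1[ is cut into consecutive
   cells of lengths [P s t], [t] ranging over [S]; a number [y] selects the
   successor [step s y] whose cell contains it, and is then rescaled to
   [next s y] in [0, 1[ to select the following one.  The numbers whose
   trajectory starts with a given word form an interval whose length is the
   weight of that word, so the image of the uniform distribution on [0, 1[
   is the path measure. *)
Section Existence.
Variable M : markov_chain R S.
Let P := mc_trans M.
Let N := #|S|.

Let cumn (s : S) (k : nat) : R := \sum_(j < N | (j < k)%N) P s (enum_val j).
Let cum (s t : S) : R := cumn s (enum_rank t).
Let step (s : S) (y : R) : S :=
  odflt s [pick t | (cum s t <= y) && (y < cum s t + P s t)].
Let next (s : S) (y : R) : R := (y - cum s (step s y)) / P s (step s y).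
Let traj (s : S) (y : R) (n : nat) : S :=
  (iter n (fun z => (step z.1 z.2, next z.1 z.2)) (s, y)).1.

Let cumnS s (k : 'I_N) : cumn s k.+1 = cumn s k + P s (enum_val k).
Proof.
rewrite /cumn (bigD1 k)//= addrC; congr (_ + _).
by apply: eq_bigl => j; rewrite ltnS andbC -ltn_neqAle.
Qed.

Let cumn_le s (k l : nat) : (k <= l)%N -> cumn s k <= cumn s l.
Proof.
move=> kl; rewrite /cumn [leLHS]big_mkcond [leRHS]big_mkcond/=.
apply: ler_sum => j _; case: ifPn => [jk|_].
  by rewrite (leq_trans jk kl).
by case: ifP => // _; exact: mc_trans_ge0.
Qed.

Let cumnT s : cumn s N = 1.
Proof.
rewrite -(mc_trans_sum1 M s) /cumn.
under eq_bigl do rewrite ltn_ord.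
by rewrite [RHS](reindex _ (onW_bij _ (@enum_val_bij S))).
Qed.

Let cum_next s t : cum s t + P s t = cumn s (enum_rank t).+1.
Proof. by rewrite cumnS enum_rankK. Qed.

Let cell_uniq s t t' y : cum s t <= y < cum s t + P s t ->
  cum s t' <= y < cum s t' + P s t' -> t = t'.
Proof.
wlog tt' : t t' / (enum_rank t <= enum_rank t')%N.
  move=> H h h'; have [?|/ltnW ?] := leqP (enum_rank t) (enum_rank t').
    exact: H.
  by apply/esym; exact: H.
rewrite !cum_next => /andP[_ y1] /andP[y2 _].
have := tt'; rewrite leq_eqVlt => /orP[/eqP/val_inj/enum_rank_inj//|lt].
by have := lt_le_trans y1 (le_trans (cumn_le s lt) y2); rewrite ltxx.
Qed.

Let cell_ex s y : 0 <= y < 1 -> exists t, cum s t <= y < cum s t + P s t.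
Proof.
move=> /andP[y0 y1].
have ex : exists k, y < cumn s k by exists N; rewrite cumnT.
case: (ex_minnP ex) => k yk kmin.
have kN : (k <= N)%N by apply: kmin; rewrite cumnT.
case: k => [|k] in yk kmin kN *.
  by move: yk; rewrite /cumn big_pred0// ltNge y0.
exists (enum_val (Ordinal kN)).
rewrite cum_next /cum !enum_valK /= yk andbT leNgt.
by apply/negP => /kmin; rewrite ltnn.
Qed.

Let stepP s y t : 0 <= y < 1 ->
  (step s y = t) <-> (cum s t <= y < cum s t + P s t).
Proof.
move=> y01; rewrite /step; case: pickP => [t' t'y|no] /=.
  by split=> [<-//|]; exact: cell_uniq.
by have [t' t'y] := cell_ex s y01; rewrite no in t'y.
Qed.

Let next01 s y : 0 <= y < 1 -> 0 <= next s y < 1.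
Proof.
move=> y01; have /(stepP _ _ y01) := erefl (step s y).
rewrite /next; move: (step s y) => t /andP[h1 h2].
have Pt : 0 < P s t by lra.
apply/andP; split; first by apply: divr_ge0; [rewrite subr_ge0|exact: ltW].
by rewrite ltr_pdivrMr// mul1r; lra.
Qed.

Let trajS s y n : traj s y n.+1 = traj (step s y) (next s y) n.
Proof. by rewrite /traj iterSr. Qed.

Fixpoint word_lo s (w : seq S) : R :=
  if w is t :: w' then cum s t + P s t * word_lo t w' else 0.

Let word_weight_ge0 s w : 0 <= word_weight M s w.
Proof. by elim: w s => //= t w ih s; rewrite mulr_ge0// mc_trans_ge0. Qed.

Let traj_cell s w y :
  (0 <= y < 1 /\ mkseq (traj s y) (size w).+1 = s :: w) <->
  (word_lo s w <= y < word_lo s w + word_weight M s w).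
Proof.
elim: w s y => [|t w ih] s y /=.
  by rewrite add0r; split=> [[]|].
rewrite -/P; set l := word_lo t w; set p := word_weight M t w.
have mkS : mkseq (traj s y) (size w).+2 =
    s :: mkseq (traj (step s y) (next s y)) (size w).+1.
  rewrite /mkseq -[iota 0 (size w).+2]/(0%N :: iota (1 + 0) (size w).+1).
  rewrite iotaDl map_cons -map_comp; congr (_ :: _).
  by apply: eq_map => i /=; rewrite -trajS.
split.
  move=> [y01]; rewrite mkS => /eqP; rewrite eqseq_cons eqxx => /eqP e1.
  have e0 : step s y = t by have := congr1 (head s) e1.
  rewrite e0 in e1.
  have /ih := conj (next01 s y01) e1.
  rewrite -/l -/p /next e0 => /andP[h1 h2].
  have /(stepP _ _ y01)/andP[h3 h4] := e0.
  have Pt : 0 < P s t by lra.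
  move: h1 h2; rewrite ler_pdivlMr// ltr_pdivrMr// => h1 h2.
  by apply/andP; split; lra.
move=> /andP[h1 h2].
have Pp : 0 < P s t * p by lra.
have Pt : 0 < P s t.
  rewrite lt_neqAle mc_trans_ge0 andbT eq_sym.
  by apply: contraTneq Pp => ->; rewrite mul0r ltxx.
pose z := (y - cum s t) / P s t.
have /ih[z01 mz] : l <= z < l + p.
  by rewrite /z ler_pdivlMr// ltr_pdivrMr//; apply/andP; split; lra.
have yz : y = cum s t + P s t * z.
  by rewrite /z mulrC divfK ?gt_eqF// addrC subrK.
have cell : cum s t <= y < cum s t + P s t.
  move/andP: z01 => [z0 z1]; rewrite yz lerDl mulr_ge0 ?(ltW Pt)//=.
  by rewrite ltrD2l gtr_pMr.
have y01 : 0 <= y < 1.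
  move: cell; rewrite cum_next => /andP[c0 c1]; apply/andP; split.
    by apply: le_trans c0; apply: sumr_ge0 => j _; exact: mc_trans_ge0.
  by apply: lt_le_trans c1 _; rewrite -(cumnT s); exact: cumn_le.
split=> //; rewrite mkS; have e0 := (stepP s t y01).2 cell.
have -> : next s y = z by rewrite /next e0.
by rewrite e0 mz.
Qed.

Let word_set w : set R :=
  [set y | 0 <= y < 1 /\ mkseq (traj (mc_init M) y) (size w) = w].

Let measurable_word_set w : measurable (word_set w) /\
  (@lebesgue_measure R) (word_set w) = (word_prob M w)%:E.
Proof.
case: w => [|s w].
  rewrite (_ : word_set [::] = `[0, 1[%classic).
    by rewrite lebesgue_measure_itv/= lte01 oppr0 adde0.
  by apply/seteqP; split=> y; rewrite /word_set /= in_itv/=; [case|split].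
rewrite /word_prob; case: eqVneq => [->|sM]; rewrite ?mul1r ?mul0r.
  rewrite (_ : word_set _ = `[word_lo (mc_init M) w,
      word_lo (mc_init M) w + word_weight M (mc_init M) w[%classic).
    split=> //; rewrite lebesgue_measure_itv/= lte_fin ltrDl.
    rewrite lt_neqAle word_weight_ge0 andbT; case: eqVneq => [<-//|_] /=.
    by rewrite -EFinB addrAC subrr add0r.
  by apply/seteqP; split=> y; rewrite /= in_itv/= => /traj_cell.
rewrite (_ : word_set _ = set0) ?measure0//.
apply/seteqP; split=> y //= -[_ /(congr1 (head s))] /= e.
by rewrite -e eqxx in sM.
Qed.

Lemma path_measure_exists :
  exists mu : probability (path_space M) R, is_path_measure mu.
Proof.
pose I : set R := `[0, 1[%classic.
have mI : measurable I by exact: measurable_itv.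
pose U := mnormalize (mrestr (@lebesgue_measure R) mI) (dirac (0 : measurableTypeR R)).
have UE A : U A = (@lebesgue_measure R) (A `&` I).
  have m1 : mrestr (@lebesgue_measure R) mI [set: R] = 1%E.
    by rewrite /mrestr setTI lebesgue_measure_itv/= lte01 oppr0 adde0.
  by rewrite /U /mnormalize /= m1 gt_eqF ?lte01//= invr1 mule1.
pose g (y : R) : path_space M :=
  if 0 <= y < 1 then traj (mc_init M) y else cst (mc_init M).
have gI w : g @^-1` (@cylinder M w) `&` I = word_set w.
  apply/seteqP; split=> y /=; rewrite /I /= in_itv/= /g => -[].
    by move=> /[swap] y01; rewrite y01.
  by move=> y01; rewrite y01.
have mg : measurable_fun [set: measurableTypeR R] g.
  apply: (@measurability _ _ _ (path_space M) _ _ (@cylinders M)) => // _ [_ [w _ <-] <-]; rewrite setTI.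
  rewrite -(setUIDK (g @^-1` _) I) gI; apply: measurableU.
    exact: (measurable_word_set w).1.
  have [h|h] := pselect (@cylinder M w (cst (mc_init M))).
    rewrite (_ : _ `\` _ = ~` I); first exact: measurableC.
    apply/seteqP; split=> y /=; first by case.
    rewrite /I /= in_itv/= /g => /negP/negbTE y01; split; last by rewrite y01.
    by rewrite y01.
  rewrite (_ : _ `\` _ = set0); first exact: measurable0.
  apply/seteqP; split=> y //=; rewrite /I /= in_itv/= /g => -[+ /negP/negbTE y01].
  by rewrite y01.
pose X : {mfun measurableTypeR R >-> path_space M} :=
  @mfun_Sub _ _ (measurableTypeR R) (path_space M) g (mem_set mg).
exists (distribution U X) => w.
by rewrite -(measurable_word_set w).2 -gI -UE.
Qed.

End Existence.

Lemma path_measure_unique M (mu mu' : probability (path_space M) R) :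
  is_path_measure mu -> is_path_measure mu' ->
  forall A : set (path_space M), measurable A -> mu A = mu' A.
Proof.
move=> muP mu'P A mA.
pose G : set_system (path_of M) := @cylinders M `|` [set set0].
have cylI v w : (size v <= size w)%N -> G (@cylinder M v `&` @cylinder M w).
  move=> vw; have [e|ne] := eqVneq (take (size v) w) v; last first.
    right; apply/seteqP; split=> // p [/= pv pw]; move/eqP: ne; apply.
    by rewrite -[in LHS]pw -[RHS]pv /mkseq -map_take take_iota (minn_idPl vw).
  left; exists w => //; apply/seteqP; split=> p /=; last by case.
  move=> pw; split=> //.
  by rewrite /cylinder /= -[RHS]e -[in RHS]pw /mkseq -map_take take_iota (minn_idPl vw).
have GE : @measurable _ (path_space M) = <<s G >>.
  apply/seteqP; split; apply: smallest_sub.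
  - exact: smallest_sigma_algebra.
  - by move=> _ [w _ <-]; apply: sub_sigma_algebra; left; exists w.
  - exact: sigma_algebra_measurable.
  - move=> _ [[w _ <-]|->]; last exact: measurable0.
    by apply: sub_sigma_algebra; exists w.
refine (@measure_unique _ R (path_space M) G (fun=> setT) GE _ _ _ mu mu' _ _ A mA).
- move=> _ _ [[v _ <-]|->] [[w _ <-]|->];
    rewrite ?set0I ?setI0; try by right.
  by case/orP: (leq_total (size v) (size w)) => /cylI //; rewrite setIC.
- by move=> _; left; exists [::] => //; apply/seteqP; split.
- by rewrite bigcup_const.
- move=> _ [[w _ <-]|->]; last by rewrite !measure0.
  exact: etrans (muP w) (esym (mu'P w)).
- by move=> _; apply: (le_lt_trans (probability_le1 mu measurableT)); exact: ltey.
Qed.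

Definition path_measure M : probability (path_space M) R :=
  projT1 (cid (path_measure_exists M)).

Lemma path_measureP M : is_path_measure (path_measure M).
Proof. exact: projT2 (cid (path_measure_exists M)). Qed.

Definition reach M (T : {set S}) : set (path_space M) :=
  [set p | exists k : nat, p k \in T].

Definition mc_satisfies M (T : {set S}) (lambda : R) : Prop :=
  (path_measure M (@reach M T) <= lambda%:E)%E.

End PathMeasure.

(* The parameters are indexed by ['I_n]. *)
Record pmc (S : finType) (n : nat) := PMC {
  pmc_init : S;
  pmc_trans : S -> S -> mpoly n rat }.

Section Instantiation.
Context {R : realType} {S : finType} {n : nat}.
Implicit Types (D : pmc S n) (u : n.-tuple R).

Definition pmc_eval D u (s t : S) : R :=
  mmap ratr (tnth u) (pmc_trans D s t).

Definition well_defined D u : Prop :=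
  (forall s t, 0 <= pmc_eval D u s t) /\
  (forall s, \sum_t pmc_eval D u s t = 1).

Definition graph_preserving D u : Prop :=
  forall s t, pmc_trans D s t != 0 -> 0 < pmc_eval D u s t <= 1.

Definition param_space D : set (n.-tuple R) :=
  [set u | well_defined D u /\ graph_preserving D u].

Definition instantiate D u (uD : param_space D u) : markov_chain R S :=
  MarkovChain (pmc_init D) uD.1.1 uD.1.2.

Definition sat_region D (T : {set S}) (lambda : R) : set (n.-tuple R) :=
  [set u | exists uD : param_space D u, mc_satisfies (instantiate uD) T lambda].

End Instantiation.

Record umc (R : realType) (S : finType) (n : nat) := UMC {
  umc_pmc :> pmc S n;
  umc_distr : probability (n.-tuple R) R;
  umc_distr_param : umc_distr (param_space umc_pmc) = 1%E }.

Definition sat_prob (R : realType) (S : finType) (n : nat) (D : umc R S n)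
    (T : {set S}) (lambda : R) : \bar R :=
  (\int[umc_distr D]_(u in param_space D) (\1_(sat_region D T lambda) u)%:E)%E.

Section Sampling.
Context (R : realType) (d d' : measure_display).
Context (Omega : measurableType d) (E : measurableType d').
Context (Pr : probability Omega R) (K : nat) (X : 'I_K -> {RV Pr >-> E}).

Definition mutually_independent : Prop :=
  forall (J : {set 'I_K}) (B : 'I_K -> set E), (forall i, measurable (B i)) ->
    (Pr (\bigcap_(i in [set` J]) (X i @^-1` B i)) =
     \prod_(i in J) Pr (X i @^-1` B i))%E.

Definition iid_samples (P : probability E R) : Prop :=
  mutually_independent /\
  (forall i (B : set E), measurable B -> distribution Pr (X i) B = P B).

End Sampling.

(* Main.v *)
(* If p denotes the satisfaction probability, the K independent samples all lie
   in the satisfaction region with probability p ^ K.  When p < 1 - nu this is at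
   most (1 - nu) ^ K, which is the first summand of alpha; otherwise the event is
   the whole space.  The satisfaction region is measurable because reaching T is
   the increasing union of reaching T within k steps, whose probability is a
   polynomial in the parameters. *)
Require Import Defs.
From mathcomp Require Import all_boot all_order all_algebra.
From mathcomp Require Import (canonicals) mpoly.
From mathcomp Require Import all_classical all_reals all_analysis.
From mathcomp Require Import measurable_realfun.
Import Order.TTheory GRing.Theory Num.Theory.
Local Open Scope classical_set_scope.
Local Open Scope ring_scope.

(** * Reaching the target within finitely many steps *)

Section BoundedReachability.
Context {R : realType} {S : finType}.

(* Unlike [word_weight], defined for matrices [P] that need not be stochastic:
   the parameters outside of [param_space] do not give a [markov_chain]. *)
Fixpoint weight (P : S -> S -> R) (s : S) (w : seq S) : R :=
  if w is t :: w' then P s t * weight P t w' else 1.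

Definition init_weight (s0 : S) (P : S -> S -> R) (w : seq S) : R :=
  if w is s :: w' then (s == s0)%:R * weight P s w' else 1.

Definition visiting_words (T : {set S}) (k : nat) : seq (k.-tuple S) :=
  [seq w : k.-tuple S <- enum {: k.-tuple S} | has (fun s => s \in T) w].

Definition bounded_reach_prob s0 P (T : {set S}) (k : nat) : R :=
  \sum_(w <- visiting_words T k) init_weight s0 P w.

Lemma word_probE (M : markov_chain R S) w :
  word_prob M w = init_weight (mc_init M) (mc_trans M) w.
Proof.
by case: w => //= s w; congr (_ * _); elim: w s => //= t w ih s; rewrite ih.
Qed.

(** The strict bound on [j] makes membership depend only on the prefix of length [k], hence on a
    single word; the event is empty for [k = 0]. *)
Definition bounded_reach (M : markov_chain R S) (T : {set S}) (k : nat) :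
    set (path_space M) :=
  [set p | exists2 j, (j < k)%N & p j \in T].

Lemma measurable_cylinder (M : markov_chain R S) w :
  measurable (cylinder w : set (path_space M)).
Proof. by apply: sub_sigma_algebra; exists w. Qed.

Lemma bounded_reachE (M : markov_chain R S) (T : {set S}) k :
  bounded_reach M T k =
  \bigcup_(w in [set` visiting_words T k]) (cylinder w : set (path_space M)).
Proof.
apply/seteqP; split=> [p [j jk pT]|p [w /=]].
  have sz : size (mkseq p k) == k by rewrite size_mkseq.
  exists (Tuple sz); last by rewrite /cylinder /= size_mkseq.
  rewrite /= mem_filter mem_enum andbT /=.
  by apply/hasP; exists (p j) => //; apply/mapP; exists j; rewrite ?mem_iota.
rewrite mem_filter mem_enum andbT => /hasP[s sw sT].
rewrite /cylinder /= size_tuple => pw.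
have /mapP[j] : s \in mkseq p k by rewrite pw.
by rewrite mem_iota add0n => /= jk sE; exists j => //; rewrite -sE.
Qed.

Lemma measurable_bounded_reach (M : markov_chain R S) (T : {set S}) k :
  measurable (bounded_reach M T k).
Proof.
rewrite bounded_reachE; apply: fin_bigcup_measurable => // w _.
exact: measurable_cylinder.
Qed.

(** Distinct words of the same length [k] have disjoint cylinders, so the probabilities of the
    visiting words add up. *)
Lemma path_measure_bounded_reach (M : markov_chain R S) (T : {set S}) k :
  path_measure M (bounded_reach M T k) =
  (bounded_reach_prob (mc_init M) (mc_trans M) T k)%:E.
Proof.
rewrite bounded_reachE measure_fin_bigcup//.
- rewrite -fsbig_seq ?filter_uniq -?enumT ?enum_uniq//.
  rewrite /bounded_reach_prob -sumEFin; apply: eq_bigr => w _.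
  by rewrite -word_probE; exact: path_measureP.
- move=> v w _ _ [p []]; rewrite /cylinder /= !size_tuple => pv pw.
  by apply: val_inj; rewrite /= -pv -pw.
- by move=> w _; exact: measurable_cylinder.
Qed.

(** Continuity from below along the increasing events [bounded_reach M T k] replaces the path
    measure by countably many inequalities on finite sums, which depend explicitly on the transition
    matrix. *)
Lemma mc_satisfiesP (M : markov_chain R S) (T : {set S}) (lambda : R) :
  mc_satisfies M T lambda <->
  forall k, bounded_reach_prob (mc_init M) (mc_trans M) T k <= lambda.
Proof.
have reachE : @reach R S M T = \bigcup_k bounded_reach M T k.
  apply/seteqP; split=> p; first by move=> [j pj]; exists j.+1 => //; exists j.
  by move=> [k _ [j _ pj]]; exists j.
have mr : measurable (@reach R S M T).
  rewrite reachE; apply: bigcup_measurable => k _.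
  exact: measurable_bounded_reach.
rewrite /mc_satisfies; split=> [le_lambda k|le_lambda].
  rewrite -lee_fin -path_measure_bounded_reach; apply: le_trans le_lambda.
  apply: le_measure; rewrite ?inE//; first exact: measurable_bounded_reach.
  by move=> p [j _ pj]; exists j.
have cv : path_measure M \o bounded_reach M T @ \oo -->
    path_measure M (@reach R S M T).
  rewrite reachE; apply: nondecreasing_cvg_mu.
  - by move=> k; exact: measurable_bounded_reach.
  - by rewrite -reachE.
  - move=> k l kl; apply/subsetPset => p [j jk pj].
    by exists j => //; exact: leq_trans kl.
rewrite -(cvg_lim _ cv)//; apply: lime_le; first by apply/cvg_ex; eexists; exact: cv.
by apply: nearW => k /=; rewrite path_measure_bounded_reach lee_fin.
Qed.

(** For a fixed word the weight is a finite product of constants and entries of [P u]. *)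
Lemma measurable_bounded_reach_prob d (U : measurableType d)
    (P : U -> S -> S -> R) s0 T k :
  (forall s t, measurable_fun [set: U] (fun u => P u s t)) ->
  measurable_fun [set: U] (fun u => bounded_reach_prob s0 (P u) T k).
Proof.
move=> mP; apply: measurable_sum => w.
case: (val w) => [|s {}w] /=; first exact: measurable_cst.
apply: measurable_funM; first exact: measurable_cst.
elim: w s => [|t w ih] s /=; first exact: measurable_cst.
exact: measurable_funM.
Qed.

End BoundedReachability.

(** * Measurability of the parameter space and of the satisfaction region *)

Section SatisfactionRegion.
Context {R : realType} {S : finType} {n : nat}.
Variable D : pmc S n.

Lemma measurable_pmc_eval s t :
  measurable_fun [set: n.-tuple R] (fun u => pmc_eval D u s t).
Proof.
apply: measurable_sum => m; apply: measurable_funM; first exact: measurable_cst.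
apply: measurable_prod => i _; apply: measurable_funX.
exact: measurable_tnth.
Qed.

(** As [S] is finite, membership amounts to finitely many equalities and inequalities between
    measurable functions of [u]. *)
Lemma measurable_param_space : measurable (param_space D : set (n.-tuple R)).
Proof.
have mle (f g : n.-tuple R -> R) : measurable_fun setT f ->
    measurable_fun setT g -> measurable [set u | f u <= g u].
  by move=> mf mg; rewrite -[X in measurable X]setTI; exact: measurable_fun_le.
have mlt (f g : n.-tuple R -> R) : measurable_fun setT f ->
    measurable_fun setT g -> measurable [set u | f u < g u].
  move=> mf mg; rewrite (_ : mkset _ = ~` [set u | g u <= f u]).
    by apply: measurableC; exact: mle.
  by apply/seteqP; split=> u /=; rewrite ltNge => /negP.
have mforall (I : finType) (A : I -> set (n.-tuple R)) :
    (forall i, measurable (A i)) -> measurable [set u | forall i, A i u].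
  move=> mA; rewrite (_ : mkset _ = \bigcap_(i in [set: I]) A i).
    exact: fin_bigcap_measurable.
  by apply/seteqP; split=> u Au i //; exact: Au.
apply: measurableI; first apply: measurableI.
- apply: (mforall S (fun s u => forall t, 0 <= pmc_eval D u s t)) => s.
  apply: (mforall S (fun t u => 0 <= pmc_eval D u s t)) => t.
  by apply: mle; [exact: measurable_cst|exact: measurable_pmc_eval].
- apply: (mforall S (fun s u => \sum_t pmc_eval D u s t = 1)) => s.
  rewrite -[X in measurable X]setTI.
  have ms : measurable_fun [set: n.-tuple R]
      (fun u => \sum_t pmc_eval D u s t).
    by apply: measurable_sum => t; exact: measurable_pmc_eval.
  exact: (ms measurableT [set 1] (measurable_set1 _)).
- pose A s t : set (n.-tuple R) :=
    [set u | pmc_trans D s t != 0 -> 0 < pmc_eval D u s t <= 1].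
  apply: (mforall S (fun s u => forall t, A s t u)) => s.
  apply: (mforall S (A s)) => t.
  (* The zero polynomial imposes no constraint; any other one imposes two inequalities. *)
  have [D0|D0] := eqVneq (pmc_trans D s t) 0.
    rewrite (_ : A s t = setT)//.
    by apply/seteqP; split=> // u _; rewrite /A /= D0 eqxx.
  rewrite (_ : A s t = [set u | 0 < pmc_eval D u s t] `&`
                       [set u | pmc_eval D u s t <= 1]).
    apply: measurableI; [apply: mlt|apply: mle];
      by [exact: measurable_cst|exact: measurable_pmc_eval].
  by apply/seteqP; split=> u /=; rewrite /A/=; [move/(_ D0)/andP|move/andP].
Qed.

(** By [mc_satisfiesP], countably many inequalities cut the region out of [param_space D]; they
    involve only [pmc_eval D u], which makes sense for every [u]. *)
Lemma measurable_sat_region (T : {set S}) (lambda : R) :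
  measurable (sat_region D T lambda : set (n.-tuple R)).
Proof.
rewrite (_ : sat_region _ _ _ = param_space D `&` \bigcap_k
    [set u | bounded_reach_prob (pmc_init D) (pmc_eval D u) T k <= lambda]).
  apply: measurableI; first exact: measurable_param_space.
  apply: bigcapT_measurable => k; rewrite -[X in measurable X]setTI.
  apply: measurable_fun_le => //.
  by apply: measurable_bounded_reach_prob => s t; exact: measurable_pmc_eval.
apply/seteqP; split=> u.
  (* The initial state and matrix of [instantiate uD] reduce to [pmc_init D] and [pmc_eval D u],
     whatever the proof [uD]. *)
  by move=> [uD /mc_satisfiesP le_lambda]; split=> // k _; exact: le_lambda.
by move=> [uD le_lambda]; exists uD; apply/mc_satisfiesP => k; exact: le_lambda.
Qed.

End SatisfactionRegion.

(** * Satisfaction probability and independent samples *)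

Lemma sat_probE (R : realType) (S : finType) (n : nat) (D : umc R S n)
    (T : {set S}) (lambda : R) :
  sat_prob D T lambda = umc_distr D (sat_region D T lambda).
Proof.
rewrite /sat_prob integral_indic; [|exact: measurable_param_space|
  exact: measurable_sat_region].
(* The region lies inside the domain of integration. *)
by congr (umc_distr D _); apply/setIidl => u [].
Qed.

(** Independence is applied to the full index set with the same [B] at each index; identical
    distribution makes every factor [P B]. *)
Lemma iid_samples_all_in (R : realType) (d d' : measure_display)
    (Omega : measurableType d) (E : measurableType d')
    (Pr : probability Omega R) (K : nat) (X : 'I_K -> {RV Pr >-> E})
    (P : probability E R) (B : set E) :
  iid_samples X P -> measurable B ->
  Pr [set w | forall i, B (X i w)] = (P B ^+ K)%E.
Proof.
move=> [indep same] mB.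
have -> : [set w | forall i, B (X i w)] =
    \bigcap_(i in [set` [set: 'I_K]%SET]) (X i @^-1` B).
  by apply/seteqP; split=> w Bw i; [move=> _; exact: Bw|apply: Bw; rewrite /= inE].
rewrite (indep _ (fun=> B))//.
rewrite (eq_bigr (fun=> P B)) => [|i _]; last exact: same.
by rewrite big_const cardsT card_ord; elim: (K) => // k ih; rewrite iterS ih expeS.
Qed.

Theorem theorem1 (R : realType) (S : finType) (n : nat) (D : umc R S n)
  (T : {set S}) (lambda : R) (lambda01 : 0 <= lambda <= 1)
  (K : nat) (K_ge2 : (2 <= K)%N)
  (d : measure_display) (Omega : measurableType d) (Pr : probability Omega R)
  (X : 'I_K -> {RV Pr >-> n.-tuple R}) (X_iid : iid_samples X (umc_distr D))
  (nu : R) (nu01 : 0 <= nu < 1) :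
  let alpha : R :=
    \sum_(0 <= i < 2) 'C(K, i)%:R * (1 - nu) ^+ (K - i) * nu ^+ i in
  ((1 - alpha)%:E <=
   Pr [set w : Omega | (forall i : 'I_K, sat_region D T lambda (X i w)) ->
                       (1 - nu)%:E <= sat_prob D T lambda])%E.
Proof.
cbv zeta; set alpha := \sum_(0 <= i < 2) _; have /andP[nu0 nu1] := nu01.
have onu : 0 <= 1 - nu by rewrite subr_ge0 ltW.
(* The summand at [i = 0] is the left-hand side, and the one at [i = 1] is nonnegative. *)
have alpha_ge : (1 - nu) ^+ K <= alpha.
  rewrite /alpha big_nat_recl//= big_nat1 bin0 subn0 expr0 mul1r mulr1 lerDl.
  by rewrite !mulr_ge0// exprn_ge0.
set F := sat_prob D T lambda.
(* [F] does not depend on [w], so the conclusion inside the event is either always true or always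
   false. *)
have [leF|ltF] := leP (1 - nu)%:E F.
  rewrite (_ : mkset _ = setT); last by apply/seteqP; split.
  rewrite probability_setT lee_fin gerBl (le_trans _ alpha_ge)//.
  exact: exprn_ge0.
(* With a false conclusion, the implication says that some sample falls outside the region. *)
rewrite (_ : mkset _ = ~` [set w | forall i, sat_region D T lambda (X i w)]).
  have mB : measurable (sat_region D T lambda : set (n.-tuple R)).
    exact: measurable_sat_region.
  rewrite probability_setC; last first.
    rewrite (_ : mkset _ =
        \bigcap_(i in [set: 'I_K]) (X i @^-1` sat_region D T lambda)).
      apply: fin_bigcap_measurable => // i _.
      by rewrite -[X in measurable X]setTI; exact: measurable_funP.
    by apply/seteqP; split=> w Bw i; [move=> _|]; exact: (Bw i).
  rewrite (iid_samples_all_in _ _ _ _ _ _ _ _ _ _ X_iid mB) -sat_probE -/F.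
  have F0 : (0 <= F)%E by rewrite /F sat_probE.
  (* Finiteness of [F] moves the comparison to real numbers, where the power [K] is monotone on
     nonnegative arguments. *)
  have Ffin : F \is a fin_num by rewrite /F sat_probE fin_num_measure.
  move: ltF F0; rewrite -(fineK Ffin) -EFin_expe -EFinB !lee_fin lte_fin => ltF F0.
  rewrite lerD2l lerN2 (le_trans _ alpha_ge)//.
  by rewrite lerXn2r// ?nnegrE// ltW.
by apply/seteqP; split=> w nall /nall.
Qed.
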